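(* For all $n\ge 3$, $\mathrm{r}_n(2143)=5\cdot 2^{n-2}-4$.
   Context: $\mathcal{S}_n$ is the set of permutations of $[n]$, $\pi^r$ the reversal of $\pi$. A word $w$ contains $\rho\in\mathcal{S}_k$ if some subsequence $w_{i_1}\cdots w_{i_k}$ ($i_1<\cdots<i_k$) satisfies $w_{i_a}\le w_{i_b}$ iff $\rho_a\le\rho_b$; otherwise it avoids $\rho$. $\mathcal{R}_n=\{\pi\pi^r:\pi\in\mathcal{S}_n\}$ (concatenation of $\pi$ with its reversal), and $\mathrm{r}_n(\rho)$ is the number of members of $\mathcal{R}_n$ avoiding $\rho$. *)

(* Defs.v *)
From mathcomp Require Import all_boot all_fingroup.

Set Implicit Arguments.
Unset Strict Implicit.
Unset Printing Implicit Defensive.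

(* Permutations of [n] are taken in 'S_n, i.e. on {0, ..., n-1}; the shift of
   the alphabet by one does not affect order comparisons of letters. *)

Definition one_line n (s : 'S_n) : n.-tuple 'I_n := [tuple s i | i < n].

(* The positions i_1 < ... < i_k of the subsequence are given by the finite
   function f. *)
Definition contains n l k (w : l.-tuple 'I_n) (rho : 'S_k) : bool :=
  [exists f : {ffun 'I_k -> 'I_l},
     [forall a : 'I_k, forall b : 'I_k, (a < b) ==> (f a < f b)] &&
     [forall a : 'I_k, forall b : 'I_k,
        (tnth w (f a) <= tnth w (f b)) == (rho a <= rho b)]].

Definition avoids n l k (w : l.-tuple 'I_n) (rho : 'S_k) : bool :=
  ~~ contains w rho.

Definition perm_rev_word n (s : 'S_n) : (n + n).-tuple 'I_n :=
  [tuple of one_line s ++ rev (one_line s)].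

Definition Rn n : {set (n + n).-tuple 'I_n} :=
  [set perm_rev_word s | s : 'S_n].

Definition rn n k (rho : 'S_k) : nat :=
  #|[set w in Rn n | avoids w rho]|.

(* As a product of transpositions; see p2143_one_line. *)
Definition p2143 : 'S_4 :=
  (tperm (inord 0) (inord 1) * tperm (inord 2) (inord 3))%g.

Lemma p2143_one_line :
  [seq (val i).+1 | i <- one_line p2143] = [:: 2; 1; 4; 3].
Proof.
have enum4 : enum 'I_4 = [:: inord 0; inord 1; inord 2; inord 3].
  by apply: (inj_map val_inj); rewrite val_enum_ord /= !inordK.
have val_t (a b i : nat) : a < 4 -> b < 4 -> i < 4 ->
    tperm (inord a : 'I_4) (inord b) (inord i) =
    inord (if i == a then b else if i == b then a else i).
  move=> ha hb hi; have [->|nia] := eqVneq i a; first by rewrite tpermL.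
  have [->|nib] := eqVneq i b; first by rewrite tpermR.
  by rewrite tpermD // -val_eqE /= !inordK // eq_sym.
by rewrite /= enum4 /= !permM !val_t //= !inordK.
Qed.

(* Main.v *)
(* An occurrence b a d c of 2143 in pi pi^r can use the first letter v of pi
   only either as its first letter b or, through the final copy of
   v, as its last letter c. If v is the minimum or the maximum it can be
   neither, so v may be deleted. If v is the second smallest letter, then v can
   only play b; avoidance forces the larger letters, all but the smallest of
   them, to come next in decreasing order, which leaves two words, and
   symmetrically for the second largest. Any other v is impossible. Hence
   r_n = 2 r_(n-1) + 4 for n >= 4, with r_3 = 6. *)
Require Import Defs.
From mathcomp Require Import all_boot all_fingroup.
From mathcomp Require Import zify.

Set Implicit Arguments.
Unset Strict Implicit.
Unset Printing Implicit Defensive.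

(** * Subsequences of a word followed by its reversal *)

Section Mirror.
Variable T : eqType.
Implicit Types (x y z v : T) (s t w : seq T).

Definition mirror s := s ++ rev s.

Lemma mirror_cons v w : mirror (v :: w) = v :: rcons (mirror w) v.
Proof. by rewrite /mirror rev_cons /= -rcons_cat. Qed.

Lemma rev_mirror s : rev (mirror s) = mirror s.
Proof. by rewrite /mirror rev_cat revK. Qed.

Lemma mem_mirror s x : (x \in mirror s) = (x \in s).
Proof. by rewrite /mirror mem_cat mem_rev orbb. Qed.

Lemma subseq_rcons2 s t x y :
  subseq (rcons s x) (rcons t y) =
  if x == y then subseq s t else subseq (rcons s x) t.
Proof.
rewrite -subseq_rev !rev_rcons /=; case: ifP => _; first exact: subseq_rev.
by rewrite -rev_rcons subseq_rev.
Qed.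

(** The two outer copies of [v] can only serve the end letters [x] and [y]; since these differ, at
    most one of the copies is used. *)
Lemma subseq_mirror_cons x s y v w : x != y ->
  subseq (x :: rcons s y) (mirror (v :: w)) =
  [|| (x == v) && subseq (rcons s y) (mirror w),
      (y == v) && subseq (x :: s) (mirror w)
    | subseq (x :: rcons s y) (mirror w)].
Proof.
move=> nxy; rewrite mirror_cons /=.
have [exv|nxv] := eqVneq x v.
  have nyv : y != v by rewrite -exv eq_sym.
  rewrite subseq_rcons2 (negPf nyv) /=.
  (* Here the last disjunct implies the first, so it may be absorbed. *)
  case E: (subseq (x :: _) _); last by rewrite orbF.
  by rewrite (subseq_trans (subseq_cons _ x) E).
rewrite -rcons_cons subseq_rcons2.
have [eyv|//] := eqVneq y v; rewrite /=.
case E: (subseq (x :: rcons _ _) _); last by rewrite orbF.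
by rewrite (subseq_trans (subseq_rcons (x :: s) y) E).
Qed.

Lemma pair_subseq_mirror x y s : x \in s -> y \in s ->
  subseq [:: x; y] (mirror s).
Proof.
move=> xs ys; rewrite -[[:: x; y]]/([:: x] ++ [:: y]).
by apply: cat_subseq; rewrite sub1seq ?mem_rev.
Qed.

Lemma pair_subseqVrev x y s : x \in s -> y \in s -> x != y ->
  subseq [:: x; y] s \/ subseq [:: y; x] s.
Proof.
elim: s => // u s IH; rewrite !inE => xs ys nxy /=.
case/predU1P: xs => [exu|xs]; case/predU1P: ys => [eyu|ys].
- by rewrite exu eyu eqxx in nxy.
- by left; rewrite exu eqxx sub1seq.
- by right; rewrite eyu eqxx sub1seq.
have [h|h] := IH xs ys nxy; [left|right];
  exact: (subseq_trans h (subseq_cons s u)).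
Qed.

(** * Words forced by forbidding all [z x y] with [x] before [y] in [t] *)

(** This one condition serves both second-extremal first letters: [z] is the only letter beyond the
    first letter, and [t] lists all others, decreasingly if [z] is the minimum and increasingly if
    [z] is the maximum. *)
Definition confines z t w : Prop :=
  forall x y, subseq [:: x; y] t -> ~~ subseq [:: z; x; y] (mirror w).

(** If [w] began with [z], that [z] followed by [x] and a later letter of [t] would be forbidden; if
    it began with some [v] in [t], the final copy of [v] would complete [z x v]. So [w] begins with
    [x]. Conversely, the only [x] after a [z] is then the last letter of the mirror, and nothing
    follows it. *)
Lemma confines_cons z x t w : uniq (z :: x :: t) -> t != [::] ->
  perm_eq w (z :: x :: t) ->
  (confines z (x :: t) w <-> exists2 w', w = x :: w' & confines z t w').
Proof.
move=> Ut nt pw.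
have [zx zt xt] : [/\ z != x, z \notin t & x \notin t].
  by move: Ut => /=; rewrite inE negb_or => /and3P[/andP[? ?] ? _].
split.
  case: w pw => [|v w] pw; first by have := perm_size pw.
  move=> H.
  have mw u : u \in v :: w = (u \in z :: x :: t) by rewrite (perm_mem pw).
  have vt : v \in z :: x :: t by rewrite -mw mem_head.
  have inw u : u \in z :: x :: t -> u != v -> u \in w.
    by rewrite -mw inE => /predU1P[->|//]; rewrite eqxx.
  move: vt; rewrite !inE => /or3P[/eqP ev|/eqP ev|vt].
  - case: t nt pw H {Ut} zt xt mw inw => // y t _ pw H zt xt mw inw.
    rewrite !inE !negb_or in zt xt.
    have /negP[] := H x y ltac:(by rewrite /= !eqxx sub0seq).
    rewrite (@subseq_mirror_cons z [:: x] y); last by case/andP: zt.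
    rewrite ev eqxx /= pair_subseq_mirror //; apply: inw.
    + by rewrite !inE eqxx orbT.
    + by rewrite ev eq_sym.
    + by rewrite !inE eqxx !orbT.
    + by rewrite ev eq_sym; case/andP: zt.
  - exists w; first by rewrite ev.
    move=> a b ab; have ab' : subseq [:: a; b] (x :: t).
      exact: (subseq_trans ab (subseq_cons t x)).
    have := H _ _ ab'; apply: contraNN => h.
    have bt : b \in t by rewrite (mem_subseq ab) // !inE eqxx orbT.
    rewrite (@subseq_mirror_cons z [:: a] b) /= ?h ?orbT //.
    by apply: contraNneq zt => ->.
  - have /negP[] := H x v ltac:(by rewrite /= eqxx sub1seq).
    have nzv : z != v by apply: contraNneq zt => ->.
    have nxv : x != v by apply: contraNneq xt => ->.
    rewrite (@subseq_mirror_cons z [:: x] v) // eqxx /=.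
    have -> : subseq [:: z; x] (mirror w); last by rewrite orbT.
    by apply: pair_subseq_mirror; apply: inw => //; rewrite !inE eqxx ?orbT.
case=> w' ew H a b ab.
have aw : b \in x :: t by rewrite (mem_subseq ab) // !inE eqxx orbT.
have nzb : z != b.
  by apply: contraTneq aw => <-; rewrite inE negb_or zx.
rewrite ew (@subseq_mirror_cons z [:: a] b) // (negPf zx) /=.
move: ab => /=; case: (eqVneq a x) => [eax|nax] ab.
  have bt : b \in t by rewrite -sub1seq.
  have nbx : b != x by apply: contraNneq xt => <-.
  rewrite (negPf nbx) /=.
  move: pw; rewrite ew => pw.
  apply/negP => /mem_subseq/(_ a); rewrite !inE eqxx orbT mem_mirror => /(_ isT).
  have : uniq (x :: w') by rewrite (perm_uniq pw).
  by rewrite /= eax => /andP[/negPf->].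
have nbx : b != x.
  by apply: contraNneq xt => <-; rewrite (mem_subseq ab) // !inE eqxx orbT.
by rewrite (negPf nbx) /= H.
Qed.

(** The letters of [t] are peeled off in order by [confines_cons]. Once only [y] is left there is no
    pair to forbid, and both orders of [z] and [y] survive. *)
Lemma confines_iff z t y w : uniq (z :: rcons t y) ->
  perm_eq w (z :: rcons t y) ->
  (confines z (rcons t y) w <-> w = t ++ [:: z; y] \/ w = t ++ [:: y; z]).
Proof.
elim: t w => [|x t IH] w Ut pw.
  split=> [_|_ a b].
    have sw := perm_size pw; move: pw.
    case: w sw => // a [|b []] //= _ pw.
    have /= nab : uniq [:: a; b] by rewrite (perm_uniq pw).
    have : a \in [:: z; y] by rewrite -(perm_mem pw) mem_head.
    have : b \in [:: z; y] by rewrite -(perm_mem pw) !inE eqxx orbT.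
    move: nab; rewrite !inE andbT => nab /orP[]/eqP eb /orP[]/eqP ea.
    - by rewrite ea eb eqxx in nab.
    - by right; rewrite ea eb.
    - by left; rewrite ea eb.
    - by rewrite ea eb eqxx in nab.
  by move=> /=; case: ifP.
have nt : rcons t y != [::] by case: (t).
rewrite rcons_cons in Ut pw *.
rewrite (confines_cons Ut nt pw); split.
  case=> w' ew; rewrite ew in pw *.
  have pw' : perm_eq w' (z :: rcons t y).
    rewrite -(perm_cons x) (perm_trans pw) //.
    by rewrite -[z :: x :: _]/([:: z] ++ [:: x] ++ _) perm_catCA.
  rewrite IH //; first by case=> ->; [left|right].
  by move: Ut => /=; rewrite inE negb_or => /and3P[/andP[_ ->]].
have Ut' : uniq (z :: rcons t y).
  by move: Ut => /=; rewrite inE negb_or => /and3P[/andP[_ ->]].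
move=> ew; have [w' {}ew ew'] :
    exists2 w', w = x :: w' & w' = t ++ [:: z; y] \/ w' = t ++ [:: y; z].
  by case: ew => ->; [exists (t ++ [:: z; y])|exists (t ++ [:: y; z])]; auto.
exists w' => //; apply/IH => //.
rewrite -(perm_cons x) -ew (perm_trans pw) //.
by rewrite -[z :: x :: _]/([:: z] ++ [:: x] ++ _) perm_catCA.
Qed.

End Mirror.

(** * Avoidance of 2143 and removal of the first letter *)

Definition mirror_avoids s : Prop := forall a b c d,
  a < b -> b < c -> c < d -> ~~ subseq [:: b; a; d; c] (mirror s).

Definition extremal x s := all (ltn x) s || all (gtn x) s.

Lemma mirror_avoids_cons v w : mirror_avoids (v :: w) <->
  [/\ mirror_avoids w,
      forall a c d, a < v -> v < c -> c < d ->
        ~~ subseq [:: a; d; c] (mirror w)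
    & forall a b d, a < b -> b < v -> v < d ->
        ~~ subseq [:: b; a; d] (mirror w)].
Proof.
split=> [H|[Hw Hb Hc] a b c d ab bc cd].
  split=> [a b c d ab bc cd|a c d av vc cd|a b d ab bv vd].
  - have := H a b c d ab bc cd; apply: contraNN => h.
    rewrite (@subseq_mirror_cons _ b [:: a; d] c) /= ?h ?orbT //.
    by rewrite neq_ltn bc.
  - have := H a v c d av vc cd; apply: contraNN => h.
    rewrite (@subseq_mirror_cons _ v [:: a; d] c) /= ?h ?eqxx //.
    by rewrite neq_ltn vc.
  - have := H a b v d ab bv vd; apply: contraNN => h.
    rewrite (@subseq_mirror_cons _ b [:: a; d] v) /= ?h ?eqxx ?orbT //.
    by rewrite neq_ltn bv.
rewrite (@subseq_mirror_cons _ b [:: a; d] c) /=; last by rewrite neq_ltn bc.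
rewrite !negb_or !negb_and Hw // andbT.
apply/andP; split; apply/orP.
  by have [ebv|] := eqVneq b v; [right; apply: Hb; rewrite -?ebv|left].
by have [ecv|] := eqVneq c v; [right; apply: Hc; rewrite -?ecv|left].
Qed.

(** In an occurrence both [b] and [c] have a smaller and a larger letter beside them, which an
    extremal [v] lacks. *)
Lemma mirror_avoids_cons_extremal v w : extremal v w ->
  mirror_avoids (v :: w) <-> mirror_avoids w.
Proof.
move=> Hv; rewrite mirror_avoids_cons; split=> [[]//|Hw].
split=> // [a c d av vc cd|a b d ab bv vd]; apply/negP => /mem_subseq H.
  have := H a; have := H c; rewrite !mem_mirror !inE !eqxx !orbT.
  move=> /(_ isT) cw /(_ isT) aw.
  by case/orP: Hv => /allP h; [have /= := h a aw|have /= := h c cw]; lia.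
have := H b; have := H d; rewrite !mem_mirror !inE !eqxx !orbT.
move=> /(_ isT) dw /(_ isT) bw.
by case/orP: Hv => /allP h; [have /= := h b bw|have /= := h d dw]; lia.
Qed.

(** Each letter of the monotone prefix [s] is extremal among the letters after it, so the prefix can
    be removed letter by letter. *)
Lemma mirror_avoids_cat (r : rel nat) s u : (r = ltn \/ r = gtn) ->
  pairwise r s -> allrel r s u -> mirror_avoids u -> mirror_avoids (s ++ u).
Proof.
move=> Hr; elim: s => //= x s IH /andP[xs ps]; rewrite allrel_consl.
case/andP=> xu su Hu; apply/mirror_avoids_cons_extremal; last exact: IH.
by case: Hr => er; rewrite er in xs xu; rewrite /extremal !all_cat xs xu ?orbT.
Qed.

(** An occurrence needs four distinct letters, and the mirror has no letters other than those of
    [s]. *)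
Lemma mirror_avoids_short s : size s < 4 -> mirror_avoids s.
Proof.
move=> ss a b c d ab bc cd; apply/negP => /mem_subseq H.
have U : uniq [:: b; a; d; c] by rewrite /= !inE; lia.
have /(uniq_leq_size U) /= : {subset [:: b; a; d; c] <= s}.
  by move=> x /H; rewrite mem_mirror.
by rewrite leqNgt ss.
Qed.

(** * Possible first letters of an avoiding arrangement of an interval *)

Lemma perm_iota_cons v w m k :
  perm_eq (v :: w) (iota m k.+1) ->
  [/\ m <= v < m + k.+1, uniq w
    & forall x, (x \in w) = (m <= x < m + k.+1) && (x != v)].
Proof.
move=> pw; have U : uniq (v :: w) by rewrite (perm_uniq pw) iota_uniq.
have M x : (x \in v :: w) = (m <= x < m + k.+1) by rewrite (perm_mem pw) mem_iota.
split; [by rewrite -M mem_head|by case/andP: U|move=> x].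
rewrite -M inE; have [->|//] := eqVneq x v; first by case/andP: U => /negPf->.
by rewrite andbT.
Qed.

Lemma perm_iota_min w m k :
  perm_eq (m :: w) (iota m k.+1) = perm_eq w (iota m.+1 k).
Proof. by rewrite /= perm_cons. Qed.

Lemma perm_iota_max w m k :
  perm_eq (m + k :: w) (iota m k.+1) = perm_eq w (iota m k).
Proof.
rewrite -addn1 iotaD /= cats1.
by rewrite perm_sym perm_rcons perm_cons perm_sym.
Qed.

(* A first letter with two smaller and two larger letters creates an
   occurrence whichever of the extreme letters comes first in the rest. *)
Lemma mirror_avoids_head v w m k : perm_eq (v :: w) (iota m k.+4) ->
  mirror_avoids (v :: w) ->
  [\/ v = m, v = m + k.+3, v = m.+1 | v = m + k.+2].
Proof.
move=> pw /mirror_avoids_cons[_ Hb Hc].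
have [mv Uw M] := perm_iota_cons pw.
have [/eqP|nv1] := boolP (v == m); first by constructor 1.
have [/eqP|nv2] := boolP (v == m + k.+3); first by constructor 2.
have [/eqP|nv3] := boolP (v == m.+1); first by constructor 3.
have [/eqP|nv4] := boolP (v == m + k.+2); first by constructor 4.
exfalso.
have mw : m \in w by rewrite M; lia.
have dw : m + k.+3 \in w by rewrite M; lia.
have bw : m.+1 \in w by rewrite M; lia.
have cw : m + k.+2 \in w by rewrite M; lia.
have nmd : m != m + k.+3 by lia.
(* If the minimum precedes the maximum in [w], then [v] plays [b] and the letter [c] comes from the
   reversed half. Otherwise the reversed half has the minimum first, [m.+1] from [w] plays [b], and
   the final [v] plays [c]. *)
have [h|h] := pair_subseqVrev mw dw nmd.
  have /negP[] := Hb m (m + k.+2) (m + k.+3) ltac:(lia) ltac:(lia) ltac:(lia).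
  rewrite -[[:: _; _; _]]/([:: m; m + k.+3] ++ [:: m + k.+2]).
  by apply: cat_subseq; rewrite ?sub1seq ?mem_rev.
have /negP[] := Hc m m.+1 (m + k.+3) ltac:(lia) ltac:(lia) ltac:(lia).
rewrite -[[:: _; _; _]]/([:: m.+1] ++ [:: m; m + k.+3]).
apply: cat_subseq; rewrite ?sub1seq //.
by rewrite -subseq_rev revK.
Qed.

Lemma pair_subseq_iota a b m k :
  subseq [:: a; b] (iota m k) = [&& m <= a, a < b & b < m + k].
Proof.
elim: k m => [|k IH] m; first by apply/esym/negP => /and3P[]; lia.
rewrite [iota _ _]/= [LHS]/=; case: eqP => [->|nam].
  by rewrite sub1seq mem_iota; lia.
by rewrite IH; lia.
Qed.

(** Only [m] lies below the first letter, so the final copy cannot play [c]. The condition for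
    playing [b] forbids [m d c] with [d > c], which is [confines] for the decreasing list of larger
    letters. *)
Lemma mirror_avoids_second_min w m k : perm_eq (m.+1 :: w) (iota m k.+4) ->
  mirror_avoids (m.+1 :: w) <->
  let t := rev (iota m.+3 k.+1) in
  w = t ++ [:: m; m.+2] \/ w = t ++ [:: m.+2; m].
Proof.
move=> pw; set t := rev _ => /=.
have [mv Uw M] := perm_iota_cons pw.
have et : rcons t m.+2 = rev (iota m.+2 k.+2) by rewrite [iota _ _]/= rev_cons.
have U : uniq (m :: rcons t m.+2).
  by rewrite et cons_uniq rev_uniq mem_rev iota_uniq mem_iota; lia.
have pw' : perm_eq w (m :: rcons t m.+2).
  apply: uniq_perm => // x; rewrite M et inE mem_rev mem_iota; lia.
rewrite -(confines_iff U pw'); split=> [/mirror_avoids_cons[_ Hb _]|H].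
  move=> d c; rewrite et -subseq_rev revK pair_subseq_iota => dc.
  by apply: Hb; lia.
apply/mirror_avoids_cons; split.
(* The rest [w] avoids the pattern by its shape: the prefix [t] decreases and stays above the last
   two letters. *)
- have tm x : x \in t -> m.+2 < x by rewrite mem_rev mem_iota; lia.
  have pt : pairwise gtn t.
    rewrite -sorted_pairwise; last by move=> a b c /=; lia.
    by rewrite rev_sorted iota_ltn_sorted.
  by case/(confines_iff U pw'): H => ->;
    (apply: (@mirror_avoids_cat gtn _ _ (or_intror erefl)) => //;
    [apply/allrelP => x y /tm mx; rewrite !inE => /orP[]/eqP-> /=; lia
    |exact: mirror_avoids_short]).
- move=> a c d am mc cd; apply/negP => h.
  have aw : a \in w by rewrite -mem_mirror (mem_subseq h) // mem_head.
  have dw : d \in w by rewrite -mem_mirror (mem_subseq h) // !inE eqxx orbT.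
  have ea : a = m by move: aw; rewrite M; lia.
  move: h; rewrite ea; apply/negP; apply: H.
  rewrite et -subseq_rev revK pair_subseq_iota.
  by move: dw; rewrite M; lia.
- move=> a b d ab bm md; apply/negP => h.
  have : a \in w by rewrite -mem_mirror (mem_subseq h) // !inE eqxx orbT.
  by rewrite M; lia.
Qed.

(** Only one letter exceeds the first one, so it cannot play [b]. The condition for playing [c] is
    again [confines], now for the increasing list of smaller letters. *)
Lemma mirror_avoids_second_max w m k :
  perm_eq (m + k.+2 :: w) (iota m k.+4) ->
  mirror_avoids (m + k.+2 :: w) <->
  let t := iota m k.+1 in
  w = t ++ [:: m + k.+3; m + k.+1] \/ w = t ++ [:: m + k.+1; m + k.+3].
Proof.
move=> pw; set t := iota _ _ => /=.
have [mv Uw M] := perm_iota_cons pw.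
have et : rcons t (m + k.+1) = iota m k.+2.
  by rewrite -[k.+2]addn1 iotaD /= cats1.
have U : uniq (m + k.+3 :: rcons t (m + k.+1)).
  by rewrite et cons_uniq iota_uniq mem_iota; lia.
have pw' : perm_eq w (m + k.+3 :: rcons t (m + k.+1)).
  apply: uniq_perm => // x; rewrite M et inE mem_iota; lia.
(* The mirror is a palindrome, so [b a d] can be read as [d a b], which puts the maximum first as
   [confines] requires. *)
have revE x y z : subseq [:: x; y; z] (mirror w) = subseq [:: z; y; x] (mirror w).
  by rewrite -subseq_rev rev_mirror.
rewrite -(confines_iff U pw'); split=> [/mirror_avoids_cons[_ _ Hc]|H].
  move=> a b; rewrite et pair_subseq_iota revE => ab.
  by apply: Hc; lia.
apply/mirror_avoids_cons; split.
- have tm x : x \in t -> x < m + k.+1 by rewrite mem_iota; lia.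
  have pt : pairwise ltn t.
    by rewrite -sorted_pairwise ?iota_ltn_sorted // => a b c /=; lia.
  by case/(confines_iff U pw'): H => ->;
    (apply: (@mirror_avoids_cat ltn _ _ (or_introl erefl)) => //;
    [apply/allrelP => x y /tm mx; rewrite !inE => /orP[]/eqP-> /=; lia
    |exact: mirror_avoids_short]).
- move=> a c d am mc cd; apply/negP => h.
  have : d \in w by rewrite -mem_mirror (mem_subseq h) // !inE eqxx orbT.
  by rewrite M; lia.
- move=> a b d ab bm md; apply/negP => h.
  have bw : b \in w by rewrite -mem_mirror (mem_subseq h) // mem_head.
  have aw : a \in w by rewrite -mem_mirror (mem_subseq h) // !inE eqxx orbT.
  have dw : d \in w by rewrite -mem_mirror (mem_subseq h) // !inE eqxx !orbT.
  have ed : d = m + k.+3 by move: dw; rewrite M; lia.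
  move: h; rewrite ed revE; apply/negP; apply: H.
  by rewrite et pair_subseq_iota; move: aw bw; rewrite !M; lia.
Qed.

(** * Counting by an explicit list *)

(** The lower end [m] is arbitrary so that deleting the minimum leaves another interval and no
    letter has to be renumbered. For [k = 0] all six arrangements of three letters avoid the
    pattern. *)
Lemma mirror_avoids_enum m k : exists L : seq (seq nat),
  [/\ uniq L, size L = 5 * 2 ^ k.+1 - 4
    & forall w, w \in L <-> perm_eq w (iota m k.+3) /\ mirror_avoids w].
Proof.
elim: k m => [|k IH] m.
  exists (permutations (iota m 3)); split; first exact: permutations_uniq.
    by rewrite size_permutations ?iota_uniq // size_iota.
  move=> w; rewrite mem_permutations; split=> [pw|[]//]; split=> //.
  by apply: mirror_avoids_short; rewrite (perm_size pw) size_iota.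
have [L1 [U1 s1 M1]] := IH m.+1; have [L2 [U2 s2 M2]] := IH m.
pose s := rev (iota m.+3 k.+1); pose t := iota m k.+1.
(* These are the four words that begin with the second smallest or the second largest letter. *)
pose L3 := [:: m.+1 :: s ++ [:: m; m.+2]; m.+1 :: s ++ [:: m.+2; m];
               m + k.+2 :: t ++ [:: m + k.+3; m + k.+1];
               m + k.+2 :: t ++ [:: m + k.+1; m + k.+3]].
have pair_perm (z y : nat) (r : seq nat) :
    perm_eq (r ++ [:: z; y]) (z :: rcons r y) /\
    perm_eq (r ++ [:: y; z]) (z :: rcons r y).
  split; first by rewrite -[[:: z; y]]/([:: z] ++ [:: y]) perm_catCA cats1.
  by rewrite -[[:: y; z]]/([:: y] ++ [:: z]) catA perm_catC cats1.
have L3_perm w : w \in L3 -> perm_eq w (iota m k.+4).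
  have es : rcons s m.+2 = rev (iota m.+2 k.+2).
    by rewrite [iota _ k.+2]/= rev_cons.
  have et : rcons t (m + k.+1) = iota m k.+2.
    by rewrite -[k.+2]addn1 iotaD /= cats1.
  have [s1' s2'] := pair_perm m m.+2 s.
  have [t1' t2'] := pair_perm (m + k.+3) (m + k.+1) t.
  have ps : perm_eq (m.+1 :: m :: rcons s m.+2) (iota m k.+4).
    apply: uniq_perm; rewrite ?iota_uniq // es.
      by rewrite !cons_uniq !inE !mem_rev rev_uniq iota_uniq !mem_iota; lia.
    by move=> x; rewrite !inE mem_rev !mem_iota; lia.
  have pt : perm_eq (m + k.+2 :: m + k.+3 :: rcons t (m + k.+1)) (iota m k.+4).
    apply: uniq_perm; rewrite ?iota_uniq // et.
      by rewrite !cons_uniq !inE iota_uniq !mem_iota; lia.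
    by move=> x; rewrite !inE !mem_iota; lia.
  rewrite !inE => /or4P[]/eqP->.
  - by apply: perm_trans ps; rewrite perm_cons.
  - by apply: perm_trans ps; rewrite perm_cons.
  - by apply: perm_trans pt; rewrite perm_cons.
  - by apply: perm_trans pt; rewrite perm_cons.
exists (map (cons m) L1 ++ map (cons (m + k.+3)) L2 ++ L3).
have inj_cons (x : nat) : injective (cons x) by move=> ? ? [].
split.
(* The families are told apart by their first letters; two words of [L3] with the same first letter
   differ in their last two letters. *)
- rewrite !cat_uniq !map_inj_uniq // U1 U2 /=.
  have -> /= : ~~ has (in_mem^~ (mem (map (cons m) L1)))
                 (map (cons (m + k.+3)) L2 ++ L3).
    apply/hasPn => w; rewrite mem_cat => wL; apply/mapP => -[w1 _ ew].
    move: wL; rewrite ew => /orP[/mapP[? _ []]|]; first by lia.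
    by rewrite !inE !eqseq_cons; lia.
  have -> /= : ~~ has (in_mem^~ (mem (map (cons (m + k.+3)) L2))) L3.
    apply/hasPn => w wL; apply/mapP => -[w2 _ ew]; move: wL.
    by rewrite ew !inE !eqseq_cons; lia.
  by rewrite !inE !eqseq_cons !eqseq_cat // !eqxx !eqseq_cons /=; lia.
- rewrite !size_cat !size_map s1 s2 /= [2 ^ k.+2]expnS.
  (* Positivity makes the truncated subtraction exact: with [x = 5 * 2 ^ k.+1], twice [x - 4] plus 4
     is [2 * x - 4]. *)
  have : 0 < 2 ^ k.+1 by rewrite expn_gt0.
  by lia.
case=> [|v w].
  split; last by case=> /perm_size.
  by rewrite !mem_cat => /or3P[/mapP[]//|/mapP[]//|].
split.
  rewrite !mem_cat.
  case/or3P=> [/mapP[w1 /M1[p1 A1] [-> ->]]|/mapP[w2 /M2[p2 A2] [-> ->]]|wL].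
  - split; first by rewrite perm_iota_min.
    apply/mirror_avoids_cons_extremal => //; apply/orP; left.
    by apply/allP => x; rewrite (perm_mem p1) mem_iota /=; lia.
  - split; first by rewrite perm_iota_max.
    apply/mirror_avoids_cons_extremal => //; apply/orP; right.
    by apply/allP => x; rewrite (perm_mem p2) mem_iota /=; lia.
  - have pw := L3_perm _ wL; split=> //.
    move: wL; rewrite !inE => /or4P[]/eqP[ev ew]; rewrite ev in pw *.
    + by apply/(mirror_avoids_second_min pw); left.
    + by apply/(mirror_avoids_second_min pw); right.
    + by apply/(mirror_avoids_second_max pw); left.
    + by apply/(mirror_avoids_second_max pw); right.
case=> pw Aw; rewrite !mem_cat.
have Aw' : mirror_avoids w by case/mirror_avoids_cons: Aw.
case: (mirror_avoids_head pw Aw) => ev; rewrite ev in pw Aw *.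
- by rewrite map_f //; apply/M1; split; rewrite // -perm_iota_min.
- rewrite [X in _ || (X || _)]map_f ?orbT //; apply/M2.
  by split; rewrite // -perm_iota_max.
- by case/(mirror_avoids_second_min pw): Aw => ->; rewrite !inE eqxx ?orbT.
- by case/(mirror_avoids_second_max pw): Aw => ->; rewrite !inE eqxx ?orbT.
Qed.

(** * From position functions to subsequences *)

Lemma subseq_nthP (T : eqType) (x0 : T) (s t : seq T) :
  reflect (exists ps, [/\ sorted ltn ps, all (gtn (size t)) ps
                        & s = map (nth x0 t) ps])
          (subseq s t).
Proof.
apply: (iffP idP) => [/subseqP[b sb ->]|[ps [sp bp ->]]].
  exists (mask b (iota 0 (size t))); split.
  - exact: (subseq_sorted ltn_trans (mask_subseq _ _) (iota_ltn_sorted _ _)).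
  - by apply/allP => i /mem_mask; rewrite mem_iota.
  - by rewrite map_mask map_nth_iota0 // take_size.
suff /(map_subseq (nth x0 t)) : subseq ps (iota 0 (size t)).
  by rewrite map_nth_iota0 // take_size.
(* Both lists are strictly increasing with the same members, hence equal; a filtered list is a
   subsequence. *)
have -> : ps = [seq i <- iota 0 (size t) | i \in ps].
  apply: (irr_sorted_eq ltn_trans ltnn sp).
    by rewrite sorted_filter ?iota_ltn_sorted //; apply: ltn_trans.
  move=> i; rewrite mem_filter mem_iota /=; case ip: (i \in ps) => //=.
  by have /= := allP bp _ ip; rewrite add0n => ->.
exact: filter_subseq.
Qed.

Lemma p2143E (i : 'I_4) : p2143 i = nth 0 [:: 1; 0; 3; 2] i :> nat.
Proof.
(* The letters in [p2143_one_line] start at 1, hence the predecessor. *)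
have := congr1 (fun u => (nth 0 u i).-1) p2143_one_line.
rewrite (nth_map (p2143 i)) ?size_tuple // -tnth_nth tnth_mktuple /= => ->.
by case: i => [[|[|[|[|]]]]].
Qed.

Lemma contains_p2143P n l (w : l.-tuple 'I_n) :
  reflect (exists a b c d, [/\ a < b, b < c, c < d
             & subseq [:: b; a; d; c] (map val w)])
          (contains w p2143).
Proof.
have nthw (i : 'I_l) : nth 0 (map val w) i = tnth w i.
  by rewrite (nth_map (tnth w i)) ?size_tuple // -tnth_nth.
apply: (iffP existsP) => [[f /andP[/forallP Hf /forallP Hw]]|].
  pose o i (h : i < 4) : 'I_4 := Ordinal h.
  have lef i j (hi : i < 4) (hj : j < 4) : i < j -> f (o i hi) < f (o j hj).
    by move=> ij; have /forallP/(_ (o j hj))/implyP := Hf (o i hi); apply.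
  have lew i j (hi : i < 4) (hj : j < 4) :
      (tnth w (f (o i hi)) <= tnth w (f (o j hj))) =
      (nth 0 [:: 1; 0; 3; 2] i <= nth 0 [:: 1; 0; 3; 2] j).
    by have /forallP/(_ (o j hj))/eqP-> := Hw (o i hi); rewrite !p2143E.
  pose q i (h : i < 4) : nat := tnth w (f (o i h)).
  (* The occurrence spells [b a d c], so [a], [b], [c], [d] stand at places 1, 0, 3, 2. *)
  exists (q 1 isT), (q 0 isT), (q 3 isT), (q 2 isT).
  split; rewrite ?ltnNge ?lew //.
  apply/(subseq_nthP 0).
  exists [:: val (f (o 0 isT)); val (f (o 1 isT)); val (f (o 2 isT));
             val (f (o 3 isT))].
  split; first by rewrite /= !lef.
    by rewrite /= size_map size_tuple !ltn_ord.
  by rewrite /= !nthw.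
case=> a [b [c [d [ab bc cd /(subseq_nthP 0)[ps []]]]]].
case: ps => [|p0 [|p1 [|p2 [|p3 [|]]]]] //=.
rewrite size_map size_tuple => /and4P[p01 p12 p23 _] /and5P[h0 h1 h2 h3 _].
case=> e0 e1 e2 e3.
(* The default [Ordinal h0] is just some element of ['I_l]; an index below 4 never reaches it. *)
pose f := [ffun i : 'I_4 => nth (Ordinal h0)
  [:: Ordinal h0; Ordinal h1; Ordinal h2; Ordinal h3] i].
have wf (i : 'I_4) : tnth w (f i) = nth 0 [:: b; a; d; c] i :> nat.
  by rewrite -nthw ffunE; case: i => [[|[|[|[|]]]]].
exists f; apply/andP; split; apply/forallP => i; apply/forallP => j.
  rewrite !ffunE; apply/implyP.
  by case: i => [[|[|[|[|]]]]] // ?; case: j => [[|[|[|[|]]]]] // ? /=; lia.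
rewrite !wf !p2143E; apply/eqP.
by case: i => [[|[|[|[|]]]]] // ?; case: j => [[|[|[|[|]]]]] // ? /=; lia.
Qed.

(** * Permutations as words of natural numbers *)

Definition perm_word n (s : 'S_n) : seq nat := map val (one_line s).

Lemma size_perm_word n (s : 'S_n) : size (perm_word s) = n.
Proof. by rewrite size_map size_tuple. Qed.

Lemma nth_perm_word n (s : 'S_n) (i : 'I_n) : nth 0 (perm_word s) i = s i.
Proof.
by rewrite (nth_map (s i)) ?size_tuple // -tnth_nth tnth_mktuple.
Qed.

Lemma perm_word_inj n : injective (@perm_word n).
Proof.
move=> s t est; apply/permP => i; apply/val_inj => /=.
by rewrite -!nth_perm_word est.
Qed.

(** Distinct letters make the map from positions to letters injective, and an injective map of
    ['I_n] to itself is a permutation. *)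
Lemma perm_wordP n (w : seq nat) :
  reflect (exists s : 'S_n, w = perm_word s) (perm_eq w (iota 0 n)).
Proof.
apply: (iffP idP) => [pw|[s ->]].
  have sw : size w = n by rewrite (perm_size pw) size_iota.
  have Uw : uniq w by rewrite (perm_uniq pw) iota_uniq.
  have wn (i : 'I_n) : nth 0 w i < n.
    have : nth 0 w i \in w by rewrite mem_nth ?sw.
    by rewrite (perm_mem pw) mem_iota.
  have inj : injective (fun i => Ordinal (wn i)).
    by move=> i j [] /eqP; rewrite nth_uniq ?sw // => /eqP/val_inj.
  exists (perm inj); apply: (@eq_from_nth _ 0); first by rewrite size_perm_word.
  rewrite sw => i ilt.
  by rewrite (nth_perm_word (perm inj) (Ordinal ilt)) permE.
have Us : uniq (perm_word s).
  rewrite map_inj_uniq; last exact: val_inj.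
  by rewrite /= map_inj_uniq ?enum_uniq //; apply: perm_inj.
apply: uniq_perm; rewrite ?iota_uniq // => x; rewrite mem_iota /= add0n.
apply/mapP/idP => [[y _ ->]|xn]; first exact: ltn_ord.
exists (Ordinal xn) => //; apply/tnthP; exists ((s^-1)%g (Ordinal xn)).
by rewrite tnth_mktuple permKV.
Qed.

Lemma map_val_perm_rev_word n (s : 'S_n) :
  map val (perm_rev_word s) = mirror (perm_word s).
Proof. by rewrite /mirror /perm_word -map_rev -map_cat. Qed.

(** The first half of the word gives back the permutation, so counting words in [Rn n] amounts to
    counting permutations. *)
Lemma perm_rev_word_inj n : injective (@perm_rev_word n).
Proof.
move=> s t /(congr1 (fun w : (n + n).-tuple 'I_n => take n (map val w))).
rewrite !map_val_perm_rev_word /mirror !take_size_cat ?size_perm_word //.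
exact: perm_word_inj.
Qed.

Lemma avoids_p2143P n (s : 'S_n) :
  reflect (mirror_avoids (perm_word s)) (avoids (perm_rev_word s) p2143).
Proof.
apply: (iffP negP) => H.
  move=> a b c d ab bc cd; apply/negP => h; apply: H.
  by apply/contains_p2143P; exists a, b, c, d; rewrite map_val_perm_rev_word.
case/contains_p2143P => a [b [c [d [ab bc cd]]]].
by rewrite map_val_perm_rev_word; apply/negP; apply: H.
Qed.

Theorem theorem11 (n : nat) (hn : 3 <= n) :
  rn n p2143 = 5 * 2 ^ (n - 2) - 4.
Proof.
pose A := [set s : 'S_n | avoids (perm_rev_word s) p2143].
have -> : rn n p2143 = #|A|.
  rewrite /rn -(card_imset A (@perm_rev_word_inj n)); apply: eq_card => w.
  rewrite inE; apply/andP/imsetP => [[/imsetP[s _ ->] av]|[s]].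
    by exists s; rewrite ?inE.
  by rewrite inE => av ->; split; [apply: imset_f|].
(* The letters start at 0, and [hn] ensures that [n - 3] is not truncated. *)
have [L [UL sL ML]] := mirror_avoids_enum 0 (n - 3).
have en : (n - 3).+3 = n by lia.
have -> : n - 2 = (n - 3).+1 by lia.
rewrite -sL cardE -(size_map (@perm_word n)); apply/perm_size/uniq_perm => //.
  by rewrite map_inj_uniq ?enum_uniq //; apply: perm_word_inj.
move=> w; apply/mapP/idP => [[s]|/ML[]].
  rewrite mem_enum inE => /avoids_p2143P av ->; apply/ML; split=> //.
  by rewrite en; apply/perm_wordP; exists s.
rewrite en => /perm_wordP[s ->] av; exists s => //.
by rewrite mem_enum inE; apply/avoids_p2143P.
Qed.
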